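(* Let $f\in\mathcal T$ and let $\gamma\in(-\infty,1]$ be fixed. Then the function $y\mapsto|f(\gamma+iy)|$ is monotonically decreasing on $(0,\infty)$.
   Context: Let $\Lambda:=\mathbb C\setminus[1,\infty)$. $\mathcal T$ denotes the set of all functions $f:\Lambda\to\mathbb C$ of the form $$f(z)=\int_0^1\frac{d\mu(t)}{1-tz},\qquad z\in\Lambda,$$ where $\mu$ is a Borel probability measure on $[0,1]$. ''Monotonically decreasing'' is meant in the weak sense (non-increasing). *)

(* Defs.v *)
From HB Require Import structures.
From mathcomp Require Import all_boot all_order all_algebra.
From mathcomp Require Import all_classical all_reals all_analysis.
From mathcomp Require Import complex.
Set Implicit Arguments.
Unset Strict Implicit.
Unset Printing Implicit Defensive.
Import Order.TTheory GRing.Theory Num.Theory.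
Local Open Scope classical_set_scope.
Local Open Scope ring_scope.
Local Open Scope complex_scope.

(* The slit plane C \ [1, +oo). *)
Definition Lambda {R : realType} : set R[i] :=
  ~` [set z | 1 <= complex.Re z /\ complex.Im z = 0].

(* [Rintegral] is 0 or junk on non-integrable functions.  This does not matter
   below: for z in Lambda, the map t |-> 1 / (1 - t z) is continuous, hence
   bounded, on [0, 1], so both of its parts are integrable. *)
Definition Cintegral d (T : measurableType d) (R : realType)
    (mu : {measure set T -> \bar R}) (D : set T) (g : T -> R[i]) : R[i] :=
  (\int[mu]_(t in D) complex.Re (g t)) +i* (\int[mu]_(t in D) complex.Im (g t)).

(* A Borel probability measure on [0, 1] is represented by a Borel probability
   measure on the real line that gives mass 1 to [0, 1].  A function on Lambda
   is represented by a total function, whose values outside Lambda are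
   unconstrained. *)
Definition calT {R : realType} : set (R[i] -> R[i]) :=
  [set f | exists mu : probability (measurableTypeR R) R,
     mu `[0, 1]%classic = 1%E /\
     forall z : R[i], Lambda z ->
       f z = Cintegral mu `[0, 1]%classic (fun t : R => 1 / (1 - t%:C * z))].

(* Main.v *)
(** Writing [1 - t z = a - i t y] with [a = 1 - t gamma >= 0], one has
    [|f z|^2 = \iint Re (1 / ((1 - s z) conj(1 - t z))) dmu(s) dmu(t)], and the
    symmetrized kernel, with [b = 1 - s gamma], is
    [(a b + s t Y) / ((a^2 + t^2 Y) (b^2 + s^2 Y))] where [Y = y^2].
    It is nonincreasing in [Y] pointwise in [s] and [t]. *)
Require Import Defs.
From mathcomp Require Import all_boot all_order all_algebra.
From mathcomp Require Import all_classical all_reals all_analysis.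
From mathcomp Require Import measurable_realfun complex.
From mathcomp Require Import ring lra.
Import Order.TTheory GRing.Theory Num.Theory.
Import numFieldNormedType.Exports.
Local Open Scope classical_set_scope.
Local Open Scope ring_scope.
Local Open Scope complex_scope.

(** Compactness of the segment bounds [g] there, and a bounded measurable function is integrable for
    a finite measure. *)
Lemma continuous_integrable_itv (R : realType)
    (mu : probability (measurableTypeR R) R) (a b : R) (g : R -> R) :
  continuous g -> mu.-integrable `[a, b]%classic (EFin \o g).
Proof.
move=> cg; apply: measurable_bounded_integrable => //.
- by rewrite (le_lt_trans (probability_le1 _ _)) ?ltry.
- by apply: subspace_continuous_measurable_fun => //; apply: continuous_subspaceT.
- have /compact_bounded[M [Mr MP]] : compact (g @` `[a, b]%classic).
    apply: continuous_compact; first exact: continuous_subspaceT.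
    exact: segment_compact.
  by exists M; split=> // x Mx y aby; apply: (MP _ Mx); exists y.
Qed.

Section SumSquares.
Context {d} {T : measurableType d} {R : realType} (mu : {measure set T -> \bar R}).
Variables (D : set T).
Hypothesis mD : measurable D.

Lemma integrable_comb (u v : T -> R) (p q : R) :
  mu.-integrable D (EFin \o u) -> mu.-integrable D (EFin \o v) ->
  mu.-integrable D (EFin \o (fun t => p * u t + q * v t)).
Proof.
move=> iu iv.
have := integrableD mD (integrableZl mD p iu) (integrableZl mD q iv).
by apply: eq_integrable.
Qed.

Lemma Rintegral_comb (u v : T -> R) (p q : R) :
  mu.-integrable D (EFin \o u) -> mu.-integrable D (EFin \o v) ->
  \int[mu]_(t in D) (p * u t + q * v t) =
  p * \int[mu]_(t in D) u t + q * \int[mu]_(t in D) v t.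
Proof.
move=> iu iv; rewrite RintegralD ?RintegralZl//.
- by have := integrableZl mD p iu; apply: eq_integrable.
- by have := integrableZl mD q iv; apply: eq_integrable.
Qed.

(* Integrating the pointwise inequality in [t] and then in [s] amounts to
   Tonelli on a kernel of finite rank, so linearity of the integral suffices. *)
Lemma le_sqr_Rintegral (u1 v1 u2 v2 : T -> R) :
  mu.-integrable D (EFin \o u1) -> mu.-integrable D (EFin \o v1) ->
  mu.-integrable D (EFin \o u2) -> mu.-integrable D (EFin \o v2) ->
  (forall s t, D s -> D t ->
     u2 s * u2 t + v2 s * v2 t <= u1 s * u1 t + v1 s * v1 t) ->
  (\int[mu]_(t in D) u2 t) ^+ 2 + (\int[mu]_(t in D) v2 t) ^+ 2 <=
  (\int[mu]_(t in D) u1 t) ^+ 2 + (\int[mu]_(t in D) v1 t) ^+ 2.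
Proof.
(* In each square one factor stays a constant and the other is merged into an integral in [t]. *)
move=> iu1 iv1 iu2 iv2 le21; rewrite !expr2 -!Rintegral_comb//.
apply: le_Rintegral => //; [exact: integrable_comb..|] => t Dt.
(* For fixed [t] the roles swap: the values at [t] become the constants, and the factors kept so far
   are expanded as integrals in [s]. *)
rewrite ![_ * u2 t]mulrC ![_ * u1 t]mulrC ![_ * v2 t]mulrC ![_ * v1 t]mulrC.
rewrite -!Rintegral_comb//.
apply: le_Rintegral => //; [exact: integrable_comb..|] => s Ds.
exact: le21.
Qed.

End SumSquares.

Section Kernel.
Context {R : realType}.
Implicit Types (g y s t : R).

(** The sum is |1 - t z|^2 for z = g + iy. Its second term vanishes only at t = 0, where the first
    equals 1. As [t] is any real, both parts of the kernel are continuous on the whole line. *)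
Lemma kernel_denom_gt0 g y t : 0 < y -> 0 < (1 - t * g) ^+ 2 + (t * y) ^+ 2.
Proof.
move=> y0; rewrite lt_def addr_ge0 ?sqr_ge0// andbT.
rewrite paddr_eq0 ?sqr_ge0// !sqrf_eq0 mulf_eq0 (gt_eqF y0) orbF.
apply/negP => /andP[/eqP + /eqP t0].
by rewrite t0 mul0r subr0 => /eqP; rewrite oner_eq0.
Qed.

Lemma Re_kernel g y t :
  complex.Re (1 / (1 - t%:C * (g +i* y))) =
  (1 - t * g) / ((1 - t * g) ^+ 2 + (t * y) ^+ 2).
Proof. by rewrite div1r /= !(mul0r, subr0, addr0, sub0r, sqrrN). Qed.

Lemma Im_kernel g y t :
  complex.Im (1 / (1 - t%:C * (g +i* y))) =
  t * y / ((1 - t * g) ^+ 2 + (t * y) ^+ 2).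
Proof.
by rewrite div1r /= !(mul0r, subr0, addr0, sub0r, sqrrN, mulNr, opprK).
Qed.

Lemma continuous_Re_kernel g y : 0 < y ->
  continuous (fun t => complex.Re (1 / (1 - t%:C * (g +i* y)))).
Proof.
move=> y0; under eq_fun do rewrite Re_kernel.
move=> t; apply: cvgM; last apply: cvgV; first last.
- apply: cvgD; apply: cvgM;
  do ?[apply: cvgB; first exact: cvg_cst]; by apply: cvgM => //; exact: cvg_cst.
- by rewrite gt_eqF// kernel_denom_gt0.
- by apply: cvgB; [exact: cvg_cst|apply: cvgM => //; exact: cvg_cst].
Qed.

Lemma continuous_Im_kernel g y : 0 < y ->
  continuous (fun t => complex.Im (1 / (1 - t%:C * (g +i* y)))).
Proof.
move=> y0; under eq_fun do rewrite Im_kernel.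
move=> t; apply: cvgM; last apply: cvgV; first last.
- apply: cvgD; apply: cvgM;
  do ?[apply: cvgB; first exact: cvg_cst]; by apply: cvgM => //; exact: cvg_cst.
- by rewrite gt_eqF// kernel_denom_gt0.
- by apply: cvgM => //; exact: cvg_cst.
Qed.

(* After clearing denominators, the difference of the two sides factors as
   [(Y2 - Y1)] times the sum of nonnegative terms below. *)
Lemma kernel_antitone g y1 y2 s t :
    g <= 1 -> 0 < y1 -> y1 <= y2 -> 0 <= s <= 1 -> 0 <= t <= 1 ->
  let k y := complex.Re (1 / (1 - s%:C * (g +i* y))) *
             complex.Re (1 / (1 - t%:C * (g +i* y))) +
             complex.Im (1 / (1 - s%:C * (g +i* y))) *
             complex.Im (1 / (1 - t%:C * (g +i* y))) in
  k y2 <= k y1.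
Proof.
move=> g1 y10 y12 /andP[s0 s1] /andP[t0 t1]; cbv beta zeta; rewrite !Re_kernel !Im_kernel.
have y20 := lt_le_trans y10 y12.
have := kernel_denom_gt0 g _ s y10; have := kernel_denom_gt0 g _ t y10.
have := kernel_denom_gt0 g _ s y20; have := kernel_denom_gt0 g _ t y20.
(* Here [g <= 1] enters: s g <= s <= 1, and likewise for [t]. Afterwards only the signs of [a] and
   [b] matter, so [g] is generalized away. *)
have : 0 <= 1 - s * g by nra.
have : 0 <= 1 - t * g by nra.
move: (1 - s * g) (1 - t * g) => b a a0 b0 pt2 ps2 pt1 ps1.
have kE y : 0 < b ^+ 2 + (s * y) ^+ 2 -> 0 < a ^+ 2 + (t * y) ^+ 2 ->
    b / (b ^+ 2 + (s * y) ^+ 2) * (a / (a ^+ 2 + (t * y) ^+ 2)) +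
    s * y / (b ^+ 2 + (s * y) ^+ 2) * (t * y / (a ^+ 2 + (t * y) ^+ 2)) =
    (a * b + s * t * y ^+ 2) /
    ((b ^+ 2 + (s * y) ^+ 2) * (a ^+ 2 + (t * y) ^+ 2)).
  by move=> /lt0r_neq0 n1 /lt0r_neq0 n2; field; rewrite n1 n2.
rewrite !kE// ler_pdivrMr ?mulr_gt0// [_ / _ * _]mulrAC ler_pdivlMr ?mulr_gt0//.
rewrite -subr_ge0.
(* The only negative term of the second factor, -(a b)^2 s t, is absorbed through a^2 s^2 + b^2 t^2
   - a b s t = (a s - b t)^2 + a b s t. *)
have -> : (a * b + s * t * y1 ^+ 2) *
    ((b ^+ 2 + (s * y2) ^+ 2) * (a ^+ 2 + (t * y2) ^+ 2)) -
    (a * b + s * t * y2 ^+ 2) *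
    ((b ^+ 2 + (s * y1) ^+ 2) * (a ^+ 2 + (t * y1) ^+ 2)) =
    (y2 ^+ 2 - y1 ^+ 2) *
    (a * b * ((a * s - b * t) ^+ 2 + a * s * (b * t))
     + a * b * (s * t) ^+ 2 * (y1 ^+ 2 + y2 ^+ 2)
     + (s * t) ^+ 3 * (y1 * y2) ^+ 2) by ring.
have y1' := ltW y10; have y2' := ltW y20.
apply: mulr_ge0; first by rewrite subr_ge0 lerXn2r ?nnegrE.
by rewrite ?addr_ge0 ?mulr_ge0 ?exprn_ge0 ?mulr_ge0 ?addr_ge0 ?sqr_ge0 ?mulr_ge0.
Qed.

End Kernel.

Theorem corollary1p2 (R : realType) (f : R[i] -> R[i]) (gamma : R)
    (hf : calT f) (hgamma : gamma <= 1) :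
  {in `]0, +oo[%R &,
    nonincreasing_fun (fun y : R => ComplexField.Normc.normc (f (gamma +i* y)))}.
Proof.
case: hf => mu [_ fE] y1 y2; rewrite !in_itv/= !andbT => y10 y20 y12.
have inL y : 0 < y -> Lambda (gamma +i* y).
  by move=> y0 [_ /= yE]; rewrite yE ltxx in y0.
rewrite !fE; [|exact: inL..].
(* [normc] is the square root of Re^2 + Im^2, so it suffices to compare sums of two squared
   integrals. *)
rewrite /= ler_wsqrtr//.
apply: le_sqr_Rintegral => //.
- exact/continuous_integrable_itv/continuous_Re_kernel.
- exact/continuous_integrable_itv/continuous_Im_kernel.
- exact/continuous_integrable_itv/continuous_Re_kernel.
- exact/continuous_integrable_itv/continuous_Im_kernel.
move=> s t /=; rewrite !in_itv/= => s01 t01.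
exact: kernel_antitone.
Qed.
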